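(* Let $M$ be an oriented $3$-valent map, and define $H_1(M)=\ker\big(Rubik(M)_{corner,\,side\,edge}\to Rubik(M)_{corner,\,edge}\big)$, $H_2(M)=\ker\big(Rubik(M)_{corner,\,edge}\to Rubik(M)_{corner}\big)$, $H_3(M)=\ker\big(Rubik(M)_{corner}\to Rubik(M)_{vertex}\big)$, where the maps are the restriction homomorphisms. Then: (i) $H_1(M)$ is isomorphic to a subgroup of $\mathbb{Z}_2^{|E(M)|-1}$; (ii) $H_2(M)$ is isomorphic to a subgroup of the alternating group $A_{|E(M)|}$ (via its action on $E(M)$); (iii) $H_3(M)$ is isomorphic to a subgroup of $\mathbb{Z}_3^{|V(M)|-1}$; (iv) $Rubik(M)_{vertex}$ is a subgroup of $A_{|V(M)|}$ if all faces of $M$ have odd size, and a subgroup of $S_{|V(M)|}$ otherwise.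
   Context: A $3$-valent map $M$ is a cellularly embedded $3$-regular graph on a surface; $V(M)$, $E(M)$, $Face(M)$ denote its vertices, edges and faces; the size of a face is the number of its edges. Throughout, every face boundary is a simple cycle, every edge lies in two distinct faces, and the three faces at any vertex are pairwise distinct. A corner is a pair $(F,v)$ with $v$ a vertex of face $F$; a side edge is a pair $(F,e)$ with $e$ an edge of face $F$. Side movement: let $F$ have boundary cycle $v_1,\dots,v_p$ (indices mod $p$, in a chosen direction), edges $e_i=v_iv_{i+1}$, and let $G_i$ be the face other than $F$ containing $e_i$. The side movement $sm(M,F)$ is the permutation of corners and side edges given by $(F,v_i)\mapsto(F,v_{i+1})$, $(G_{i-1},v_i)\mapsto(G_i,v_{i+1})$, $(G_i,v_i)\mapsto(G_{i+1},v_{i+1})$, $(F,e_i)\mapsto(F,e_{i+1})$, $(G_i,e_i)\mapsto(G_{i+1},e_{i+1})$, fixing everything else. $Rubik(M)$ is the group of permutations of corners and side edges generated by all $sm(M,F)$; this is $Rubik(M)_{corner,\,side\,edge}$. For a set $X$ of objects on which $Rubik(M)$ acts (corners, edges, vertices, or disjoint unions), $Rubik(M)_X$ denotes the permutation group on $X$ induced by $Rubik(M)$, the action on edges being induced from side edges $(F,e)\mapsto e$ and on vertices from corners $(F,v)\mapsto v$. *)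

(* Defs.v *)
From HB Require Import structures.
From mathcomp Require Import all_boot all_order all_fingroup all_algebra all_solvable.

Set Implicit Arguments.
Unset Strict Implicit.
Unset Printing Implicit Defensive.

Import GroupScope.

(* A dart is an edge together with one of its two directions; it starts at    *)
(* its origin and has its face on the left.  rot turns a dart                 *)
(* counterclockwise around its origin and opp reverses it, so the dart that   *)
(* follows d on the boundary of its face is rot^-1 (opp d).                   *)
Definition face_perm (D : finType) (rot opp : {perm D}) : {perm D} :=
  opp * rot^-1.

(* A rotation system (D, rot, opp) encodes a cellular embedding of a graph in *)
(* a closed connected oriented surface: vertices, edges and faces are the     *)
(* orbits of rot, opp and face_perm.  Multiple edges are not excluded.        *)
Record cubic_map := CubicMap {
  dart : finType;
  rot : {perm dart};
  opp : {perm dart};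
  dart_gt0 : 0 < #|dart|;
  opp_card : forall d, #|porbit opp d| = 2;
  rot_card : forall d, #|porbit rot d| = 3;
  map_connected : forall d d',
    connect [rel x y | (y == rot x) || (y == opp x)] d d';
  face_simple : forall d d',
    d' \in porbit (face_perm rot opp) d ->
    porbit rot d = porbit rot d' -> d = d';
  edge_two_faces : forall d,
    porbit (face_perm rot opp) d != porbit (face_perm rot opp) (opp d);
  vertex_three_faces : forall d,
    uniq [seq porbit (face_perm rot opp) x
         | x <- [:: d; rot d; rot (rot d)]]
}.

Section Cells.

Variable M : cubic_map.

Definition phi : {perm dart M} := face_perm (rot M) (opp M).

Definition vertex := {v : {set dart M} | v \in porbits (rot M)}.
Definition edge := {e : {set dart M} | e \in porbits (opp M)}.
Definition face := {F : {set dart M} | F \in porbits phi}.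

HB.instance Definition _ := SubFinite.on vertex.
HB.instance Definition _ := SubFinite.on edge.
HB.instance Definition _ := SubFinite.on face.

Definition on_face (F : face) (A : {set dart M}) : bool :=
  val F :&: A != set0.

Definition corner := {c : face * vertex | on_face c.1 (val c.2)}.
Definition side_edge := {s : face * edge | on_face s.1 (val s.2)}.

HB.instance Definition _ := SubFinite.on corner.
HB.instance Definition _ := SubFinite.on side_edge.

Definition face_size (F : face) : nat :=
  #|[set e : edge | on_face F (val e)]|.

Lemma orbit_in_porbits (s : {perm dart M}) d : porbit s d \in porbits s.
Proof. by apply: imset_f. Qed.

Definition vertex_of (d : dart M) : vertex :=
  exist _ (porbit (rot M) d) (orbit_in_porbits (rot M) d).
Definition edge_of (d : dart M) : edge :=
  exist _ (porbit (opp M) d) (orbit_in_porbits (opp M) d).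
Definition face_of (d : dart M) : face :=
  exist _ (porbit phi d) (orbit_in_porbits phi d).

(* The face across the edge of d. *)
Definition across (d : dart M) : face := face_of (opp M d).

(* The darts of F are d_1, ..., d_p, with v_i the origin of d_i, e_i the edge *)
(* of d_i, G_i = across d_i and d_(i+1) = phi d_i.  The default value of      *)
(* insubd is never taken: see the equations for side_movement below.          *)
Definition sm_corner (F : face) (c : corner) : corner :=
  let: (G, v) := val c in
  if [pick d in val F :&: val v] is Some d then
    insubd c (if G == F then F
              else if G == across d then across (phi d)
              else across d,
              vertex_of (phi d))
  else c.

Definition sm_side_edge (F : face) (s : side_edge) : side_edge :=
  let: (G, e) := val s in
  if [pick d in val F :&: val e] is Some d then
    insubd s (if G == F then F else across (phi d), edge_of (phi d))
  else s.

Definition sm_fun (F : face) (x : corner + side_edge) : corner + side_edge :=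
  match x with
  | inl c => inl (sm_corner F c)
  | inr s => inr (sm_side_edge F s)
  end.

Lemma phiE d : phi d = (rot M)^-1 (opp M d).
Proof. by rewrite permM. Qed.

Lemma rot_phi d : rot M (phi d) = opp M d.
Proof. by rewrite phiE permKV. Qed.

Lemma opp2 d : opp M (opp M d) = d.
Proof. by have := iter_porbit (opp M) d; rewrite opp_card. Qed.

Lemma rot3 d : rot M (rot M (rot M d)) = d.
Proof. by have := iter_porbit (rot M) d; rewrite rot_card. Qed.

Lemma phi_opp d : phi (opp M d) = rot M (rot M d).
Proof. by rewrite phiE opp2 -{1}(rot3 d) permK. Qed.

Lemma in_porbit1 (s : {perm dart M}) d : porbit s (s d) = porbit s d.
Proof. by have := porbit_perm s 1 d; rewrite expg1. Qed.

Lemma vertex_of_eq d d' : (vertex_of d == vertex_of d') = (d \in porbit (rot M) d').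
Proof. by rewrite -val_eqE /= eq_porbit_mem. Qed.

Lemma edge_of_eq d d' : (edge_of d == edge_of d') = (d \in porbit (opp M) d').
Proof. by rewrite -val_eqE /= eq_porbit_mem. Qed.

Lemma mem_vertex (v : vertex) d : (d \in val v) = (vertex_of d == v).
Proof.
have /imsetP[x _ ev] := valP v.
by rewrite -val_eqE ev /= eq_porbit_mem.
Qed.

Lemma mem_edge (e : edge) d : (d \in val e) = (edge_of d == e).
Proof.
have /imsetP[x _ ev] := valP e.
by rewrite -val_eqE ev /= eq_porbit_mem.
Qed.

Lemma mem_face (F : face) d : (d \in val F) = (face_of d == F).
Proof.
have /imsetP[x _ ev] := valP F.
by rewrite -val_eqE ev /= eq_porbit_mem.
Qed.

Lemma face_of_phi d : face_of (phi d) = face_of d.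
Proof. by apply: val_inj; rewrite /= in_porbit1. Qed.

Lemma vertex_of_rot d : vertex_of (rot M d) = vertex_of d.
Proof. by apply: val_inj; rewrite /= in_porbit1. Qed.

Lemma edge_of_opp d : edge_of (opp M d) = edge_of d.
Proof. by apply: val_inj; rewrite /= in_porbit1. Qed.

Lemma across_rot d : across d = face_of (rot M (rot M d)).
Proof. by rewrite -phi_opp face_of_phi. Qed.

Lemma across_phi d : face_of (rot M (phi d)) = across d.
Proof. by rewrite rot_phi. Qed.

Lemma faces_neq d :
  [/\ face_of d != face_of (rot M d), face_of d != across d
    & face_of (rot M d) != across d].
Proof.
have /= := vertex_three_faces d.
rewrite across_rot -!val_eqE /= !inE negb_or -/phi.
by case/andP=> /andP[-> ->] /andP[-> _].
Qed.

Lemma vertex_dartP d d' : vertex_of d' = vertex_of d ->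
  [\/ d' = d, d' = rot M d | d' = rot M (rot M d)].
Proof.
move/eqP; rewrite vertex_of_eq porbit_traject rot_card !inE.
by case/or3P=> /eqP->; [constructor 1|constructor 2|constructor 3].
Qed.

Lemma edge_dartP d d' : edge_of d' = edge_of d -> d' = d \/ d' = opp M d.
Proof.
move/eqP; rewrite edge_of_eq porbit_traject opp_card !inE.
by case/orP=> /eqP->; [left|right].
Qed.

Lemma face_vertex_inj d d' :
  face_of d = face_of d' -> vertex_of d = vertex_of d' -> d = d'.
Proof.
move=> ef /(congr1 val) /=; apply: face_simple.
by rewrite porbit_sym -eq_porbit_mem -/phi; move/(congr1 val): ef => /= ->.
Qed.

Lemma face_edge_inj d d' :
  face_of d = face_of d' -> edge_of d = edge_of d' -> d = d'.
Proof.
move=> ef /edge_dartP[] // ed; have [_ + _] := faces_neq d'.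
by rewrite /across -ed ef eqxx.
Qed.

Lemma on_face_vertexP (F : face) (v : vertex) :
  reflect (exists2 d, face_of d = F & vertex_of d = v) (on_face F (val v)).
Proof.
rewrite /on_face; apply: (iffP (set0Pn _)) => [[d]|[d fd vd]].
  by rewrite inE mem_face mem_vertex => /andP[/eqP ? /eqP ?]; exists d.
by exists d; rewrite inE mem_face mem_vertex fd vd !eqxx.
Qed.

Lemma on_face_edgeP (F : face) (e : edge) :
  reflect (exists2 d, face_of d = F & edge_of d = e) (on_face F (val e)).
Proof.
rewrite /on_face; apply: (iffP (set0Pn _)) => [[d]|[d fd vd]].
  by rewrite inE mem_face mem_edge => /andP[/eqP ? /eqP ?]; exists d.
by exists d; rewrite inE mem_face mem_edge fd vd !eqxx.
Qed.

Lemma sm_cornerE d (c : corner) : (val c).2 = vertex_of d ->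
  val (sm_corner (face_of d) c)
    = (if (val c).1 == face_of d then face_of d
       else if (val c).1 == across d then across (phi d)
       else across d,
       vertex_of (phi d)).
Proof.
rewrite /sm_corner; case E: (val c) => [G v]; rewrite /fst /snd => ev.
case: pickP => [d'|/(_ d)]; last first.
  by rewrite inE mem_face mem_vertex ev !eqxx.
rewrite inE mem_face mem_vertex ev => /andP[/eqP fd /eqP vd].
have -> : d' = d by apply: face_vertex_inj.
rewrite val_insubd ifT //; apply/on_face_vertexP.
case: (G == face_of d); first by exists (phi d); rewrite ?face_of_phi.
case: (G == across d).
  by exists (rot M (rot M (phi d))); rewrite ?vertex_of_rot ?across_rot.
by exists (rot M (phi d)); rewrite ?vertex_of_rot ?across_phi.
Qed.

Lemma sm_corner_fix (F : face) (c : corner) :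
  ~~ on_face F (val (val c).2) -> sm_corner F c = c.
Proof.
rewrite /sm_corner; case E: (val c) => [G v]; rewrite /fst /snd => nF.
by case: pickP => // d dF; case/set0Pn: nF; exists d.
Qed.

Lemma sm_side_edgeE d (s : side_edge) : (val s).2 = edge_of d ->
  val (sm_side_edge (face_of d) s)
    = (if (val s).1 == face_of d then face_of d else across (phi d),
       edge_of (phi d)).
Proof.
rewrite /sm_side_edge; case E: (val s) => [G e]; rewrite /fst /snd => ee.
case: pickP => [d'|/(_ d)]; last first.
  by rewrite inE mem_face mem_edge ee !eqxx.
rewrite inE mem_face mem_edge ee => /andP[/eqP fd /eqP vd].
have -> : d' = d by apply: face_edge_inj.
rewrite val_insubd ifT //; apply/on_face_edgeP.
case: (G == face_of d); first by exists (phi d); rewrite ?face_of_phi.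
by exists (opp M (phi d)); rewrite ?edge_of_opp.
Qed.

Lemma sm_side_edge_fix (F : face) (s : side_edge) :
  ~~ on_face F (val (val s).2) -> sm_side_edge F s = s.
Proof.
rewrite /sm_side_edge; case E: (val s) => [G e]; rewrite /fst /snd => nF.
by case: pickP => // d dF; case/set0Pn: nF; exists d.
Qed.

Lemma corner_facesP d (c : corner) : (val c).2 = vertex_of d ->
  [\/ (val c).1 = face_of d, (val c).1 = face_of (rot M d)
    | (val c).1 = across d].
Proof.
case: c => -[G v] /= /on_face_vertexP[x /= <- <-] /vertex_dartP[] ->.
- by constructor 1.
- by constructor 2.
- by constructor 3; rewrite across_rot.
Qed.

Lemma side_edge_facesP d (s : side_edge) : (val s).2 = edge_of d ->
  (val s).1 = face_of d \/ (val s).1 = across d.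
Proof.
by case: s => -[G e] /= /on_face_edgeP[x /= <- <-] /edge_dartP[] ->; [left|right].
Qed.

Lemma sm_corner_inj F : injective (sm_corner F).
Proof.
move=> c c'.
have [/on_face_vertexP[d fd vd]|nc] := boolP (on_face F (val (val c).2));
have [/on_face_vertexP[d' fd' vd']|nc'] := boolP (on_face F (val (val c').2)).
- move/(congr1 val); rewrite -{1}fd -fd' !sm_cornerE // => /eqP.
  rewrite xpair_eqE => /andP[/eqP eF /eqP eV]; have {eV} : phi d = phi d'.
    by apply: face_vertex_inj; rewrite ?face_of_phi ?fd ?fd'.
  move/perm_inj=> ed; subst d'; move: eF.
  have [a1 a2 a3] := faces_neq d; have [b1 b2 b3] := faces_neq (phi d).
  rewrite face_of_phi rot_phi -/(across d) in b1 b2 b3.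
  move=> eF; apply: val_inj; apply/eqP.
  rewrite [val c]surjective_pairing [val c']surjective_pairing.
  rewrite -vd -vd' xpair_eqE eqxx andbT.
  case: (corner_facesP (esym vd)) => e1; case: (corner_facesP (esym vd')) => e2;
    move: eF; rewrite e1 e2 ?eqxx //;
    rewrite ?(negPf a1) ?(negPf a2) ?(negPf a3)
      1?[face_of (rot M d) == face_of d]eq_sym
      1?[across d == face_of d]eq_sym
      ?(negPf a1) ?(negPf a2) ?(negPf a3) => /eqP;
    rewrite ?(negPf b1) ?(negPf b2) ?(negPf b3) //
      eq_sym ?(negPf b1) ?(negPf b2) ?(negPf b3) //.
- rewrite (sm_corner_fix nc') => ec; case/negP: nc'; apply/on_face_vertexP.
  by exists (phi d); rewrite ?face_of_phi // -ec -fd sm_cornerE.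
- rewrite (sm_corner_fix nc) => ec; case/negP: nc; apply/on_face_vertexP.
  by exists (phi d'); rewrite ?face_of_phi // ec -fd' sm_cornerE.
- by rewrite !sm_corner_fix.
Qed.

Lemma sm_side_edge_inj F : injective (sm_side_edge F).
Proof.
move=> s s'.
have [/on_face_edgeP[d fd ed]|ns] := boolP (on_face F (val (val s).2));
have [/on_face_edgeP[d' fd' ed']|ns'] := boolP (on_face F (val (val s').2)).
- move/(congr1 val); rewrite -{1}fd -fd' !sm_side_edgeE // => /eqP.
  rewrite xpair_eqE => /andP[/eqP eF /eqP eV]; have {eV} : phi d = phi d'.
    by apply: face_edge_inj; rewrite ?face_of_phi ?fd ?fd'.
  move/perm_inj=> edd; subst d'; move: eF.
  have [_ a2 _] := faces_neq d; have [_ b2 _] := faces_neq (phi d).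
  rewrite face_of_phi in b2.
  move=> eF; apply: val_inj; apply/eqP.
  rewrite [val s]surjective_pairing [val s']surjective_pairing.
  rewrite -ed -ed' xpair_eqE eqxx andbT.
  case: (side_edge_facesP (esym ed)) => e1; case: (side_edge_facesP (esym ed')) => e2;
    move: eF; rewrite e1 e2 ?eqxx //;
    rewrite [across d == face_of d]eq_sym ?(negPf a2) => /eqP;
    by rewrite ?(negPf b2) // eq_sym ?(negPf b2).
- rewrite (sm_side_edge_fix ns') => es; case/negP: ns'; apply/on_face_edgeP.
  by exists (phi d); rewrite ?face_of_phi // -es -fd sm_side_edgeE.
- rewrite (sm_side_edge_fix ns) => es; case/negP: ns; apply/on_face_edgeP.
  by exists (phi d'); rewrite ?face_of_phi // es -fd' sm_side_edgeE.
- by rewrite !sm_side_edge_fix.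
Qed.

Lemma sm_fun_inj F : injective (sm_fun F).
Proof.
by case=> [c|s] [c'|s'] //= [] => [/sm_corner_inj|/sm_side_edge_inj] ->.
Qed.

Definition side_movement (F : face) : {perm corner + side_edge} :=
  perm (@sm_fun_inj F).

(* The defining equations: d = d_i, and across ((phi)^-1 d) is G_(i-1). *)

Lemma side_movement_Fv d c : val c = (face_of d, vertex_of d) ->
  exists2 c', side_movement (face_of d) (inl c) = inl c'
            & val c' = (face_of d, vertex_of (phi d)).
Proof.
move=> ec; exists (sm_corner (face_of d) c); first by rewrite permE.
by rewrite sm_cornerE ec //= eqxx.
Qed.

Lemma side_movement_Gprev_v d c : val c = (across (phi^-1 d), vertex_of d) ->
  exists2 c', side_movement (face_of d) (inl c) = inl c'
            & val c' = (across d, vertex_of (phi d)).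
Proof.
move=> ec; exists (sm_corner (face_of d) c); first by rewrite permE.
rewrite sm_cornerE ec //= -across_phi permKV.
have [a1 a2 a3] := faces_neq d.
by rewrite eq_sym (negPf a1) (negPf a3).
Qed.

Lemma side_movement_Gv d c : val c = (across d, vertex_of d) ->
  exists2 c', side_movement (face_of d) (inl c) = inl c'
            & val c' = (across (phi d), vertex_of (phi d)).
Proof.
move=> ec; exists (sm_corner (face_of d) c); first by rewrite permE.
have [_ a2 _] := faces_neq d.
by rewrite sm_cornerE ec //= eq_sym (negPf a2) eqxx.
Qed.

Lemma side_movement_Fe d s : val s = (face_of d, edge_of d) ->
  exists2 s', side_movement (face_of d) (inr s) = inr s'
            & val s' = (face_of d, edge_of (phi d)).
Proof.
move=> es; exists (sm_side_edge (face_of d) s); first by rewrite permE.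
by rewrite sm_side_edgeE es //= eqxx.
Qed.

Lemma side_movement_Ge d s : val s = (across d, edge_of d) ->
  exists2 s', side_movement (face_of d) (inr s) = inr s'
            & val s' = (across (phi d), edge_of (phi d)).
Proof.
move=> es; exists (sm_side_edge (face_of d) s); first by rewrite permE.
have [_ a2 _] := faces_neq d.
by rewrite sm_side_edgeE es //= eq_sym (negPf a2).
Qed.

Lemma side_movement_fix_corner F c :
  ~~ on_face F (val (val c).2) -> side_movement F (inl c) = inl c.
Proof. by move=> nF; rewrite permE /= sm_corner_fix. Qed.

Lemma side_movement_fix_side_edge F s :
  ~~ on_face F (val (val s).2) -> side_movement F (inr s) = inr s.
Proof. by move=> nF; rewrite permE /= sm_side_edge_fix. Qed.

Definition Rubik : {group {perm corner + side_edge}} :=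
  <<[set side_movement F | F : face]>>%G.

End Cells.

(* A partial map pi : X -> option Y, onto Y, presents Y as a quotient of a    *)
(* subset of X.  A permutation g of X induces p on Y when g preserves that    *)
(* subset and p (pi x) = pi (g x); p is then unique.                          *)
Section Induced.

Variables (X Y : finType) (pi : X -> option Y).

Definition induces (g : {perm X}) (p : {perm Y}) : bool :=
  [forall x, pi (g x) == omap p (pi x)].

Definition compatible : {set {perm X}} := [set g | [exists p, induces g p]].

Definition induced (g : {perm X}) : {perm Y} := odflt 1 [pick p | induces g p].

Lemma induces1 : induces 1 1.
Proof. by apply/forallP=> x; rewrite perm1; case: (pi x) => //= y; rewrite perm1. Qed.

Lemma inducesM g h p q : induces g p -> induces h q -> induces (g * h) (p * q).
Proof.
move=> /forallP gp /forallP hq; apply/forallP=> x.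
rewrite permM (eqP (hq _)) (eqP (gp _)).
by case: (pi x) => //= y; rewrite permM.
Qed.

Lemma compatible_group_set : group_set compatible.
Proof.
apply/group_setP; split=> [|g h]; first by rewrite inE; apply/existsP; exists 1; exact: induces1.
rewrite !inE => /existsP[p gp] /existsP[q hq]; apply/existsP.
by exists (p * q); apply: inducesM.
Qed.

Canonical compatible_group := Group compatible_group_set.

Lemma compatibleP g : reflect (exists p, induces g p) (g \in compatible).
Proof. by rewrite inE; apply: existsP. Qed.

Lemma inducedP g : g \in compatible -> induces g (induced g).
Proof.
by move/compatibleP=> [p gp]; rewrite /induced; case: pickP => // /(_ p); rewrite gp.
Qed.

Hypothesis pi_onto : forall y, exists x, pi x = Some y.

Lemma induces_inj g p q : induces g p -> induces g q -> p = q.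
Proof.
move=> /forallP gp /forallP gq; apply/permP=> y; have [x ex] := pi_onto y.
by have := gp x; rewrite (eqP (gq x)) ex /= => /eqP[].
Qed.

Lemma inducedE g p : induces g p -> induced g = p.
Proof.
move=> gp; apply: (@induces_inj g) (gp); apply: inducedP.
by apply/compatibleP; exists p.
Qed.

Lemma inducedM : {in compatible &, {morph induced : g h / g * h}}.
Proof. by move=> g h cg ch; apply/inducedE/inducesM; apply: inducedP. Qed.

Definition induced_morphism : {morphism compatible >-> {perm Y}} :=
  Morphism inducedM.

End Induced.

Arguments compatible {X Y} pi.
Arguments induces {X Y} pi g p.
Arguments induced {X Y} pi g.

Lemma compatible_fun (X Y : finType) (pi : X -> option Y) (g : {perm X}) (f : Y -> Y) :
  (forall y, exists x, pi x = Some y) ->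
  (forall x, pi (g x) = omap f (pi x)) -> g \in compatible pi.
Proof.
move=> onto gf.
have fS y : exists z, f z == y.
  have [x ex] := onto y; have := gf (g^-1 x); rewrite permKV ex.
  by case: (pi _) => //= z [->]; exists z.
have fI : injective f.
  exact: can_inj (canF_sym (fun y => eqP (xchooseP (fS y)))).
apply/compatibleP; exists (perm fI); apply/forallP=> x; rewrite gf.
by case: (pi x) => //= y; rewrite permE.
Qed.

Section InducedComp.

Variables (X Y Z : finType) (G : {group {perm X}}).
Variables (pi : X -> option Y) (pj : Y -> option Z) (pk : X -> option Z).
Hypotheses (pi_onto : forall y, exists x, pi x = Some y)
           (pj_onto : forall z, exists y, pj y = Some z)
           (pk_onto : forall z, exists x, pk x = Some z).
Hypotheses (sGi : G \subset compatible pi) (sGk : G \subset compatible pk).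
Hypothesis pkE : forall x, pk x = obind pj (pi x).

Lemma induced_comp g : g \in G -> induces pj (induced pi g) (induced pk g).
Proof.
move=> Gg; have /inducedP/forallP gi := subsetP sGi _ Gg.
have /inducedP/forallP gk := subsetP sGk _ Gg.
apply/forallP=> y; have [x ex] := pi_onto y.
by have := gk x; rewrite !pkE (eqP (gi x)) ex.
Qed.

Lemma induced_sub : induced_morphism pi_onto @* G \subset compatible pj.
Proof.
rewrite morphimEsub //; apply/subsetP=> _ /imsetP[g Gg ->].
by apply/compatibleP; exists (induced pk g); apply: induced_comp.
Qed.

Lemma induced_im :
  induced_morphism pj_onto @* (induced_morphism pi_onto @* G)
    = induced_morphism pk_onto @* G.
Proof.
rewrite (morphimEsub _ induced_sub) !morphimEsub // -imset_comp.
by apply: eq_in_imset => g Gg /=; apply/inducedE/induced_comp.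
Qed.

End InducedComp.

Arguments induced_sub {X Y Z G pi pj pk} pi_onto.
Arguments induced_im {X Y Z G pi pj pk} pi_onto pj_onto pk_onto.

Section RubikGroups.

Variable M : cubic_map.

Definition to_corner_edge (x : corner M + side_edge M)
    : option (corner M + edge M) :=
  match x with
  | inl c => Some (inl c)
  | inr s => Some (inr (val s).2)
  end.

Definition corner_part (E : Type) (x : corner M + E) : option (corner M) :=
  if x is inl c then Some c else None.

Definition edge_part (x : corner M + edge M) : option (edge M) :=
  if x is inr e then Some e else None.

Definition to_vertex (c : corner M) : option (vertex M) := Some (val c).2.

Definition vertex_part (x : corner M + side_edge M) : option (vertex M) :=
  if x is inl c then Some (val c).2 else None.

Lemma vertex_onto v : exists c, to_vertex c = Some v.
Proof.
case: v => A vA; case/imsetP: (vA) => d _ eA.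
have vE : exist _ A vA = vertex_of d by apply: val_inj.
have oc : on_face (face_of d) (val (vertex_of d)) by apply/on_face_vertexP; exists d.
by exists (exist _ (face_of d, vertex_of d) oc); rewrite /to_vertex /= vE.
Qed.

Lemma edge_onto (e : edge M) : exists s : side_edge M, (val s).2 = e.
Proof.
case: e => A eA; case/imsetP: (eA) => d _ eAd.
have eE : exist _ A eA = edge_of d by apply: val_inj.
have oe : on_face (face_of d) (val (edge_of d)) by apply/on_face_edgeP; exists d.
by exists (exist _ (face_of d, edge_of d) oe); rewrite /= eE.
Qed.

Lemma to_corner_edge_onto y : exists x, to_corner_edge x = Some y.
Proof.
case: y => [c|e]; first by exists (inl c).
by have [s es] := edge_onto e; exists (inr s); rewrite /= es.
Qed.

Lemma corner_part_onto (E : Type) c : exists x, @corner_part E x = Some c.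
Proof. by exists (inl c). Qed.

Lemma edge_part_onto e : exists x, edge_part x = Some e.
Proof. by exists (inr e). Qed.

Lemma vertex_part_onto v : exists x, vertex_part x = Some v.
Proof. by have [c ec] := vertex_onto v; exists (inl c). Qed.

Definition Rubik_corner_edge : {group {perm corner M + edge M}} :=
  (induced_morphism to_corner_edge_onto @* Rubik M)%G.

Definition Rubik_corner : {group {perm corner M}} :=
  (induced_morphism (@corner_part_onto (side_edge M)) @* Rubik M)%G.

Definition Rubik_vertex : {group {perm vertex M}} :=
  (induced_morphism vertex_part_onto @* Rubik M)%G.

Definition H1 : {group {perm corner M + side_edge M}} :=
  ('ker_(Rubik M) (induced_morphism to_corner_edge_onto))%G.

Definition H2 : {group {perm corner M + edge M}} :=
  ('ker_Rubik_corner_edge (induced_morphism (@corner_part_onto (edge M))))%G.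

Definition H3 : {group {perm corner M}} :=
  ('ker_Rubik_corner (induced_morphism vertex_onto))%G.

Definition edge_action : {morphism compatible edge_part >-> {perm edge M}} :=
  induced_morphism edge_part_onto.

(* 'ker and @* only see the domain of a morphism; the lemmas below show that  *)
(* the groups above lie in the domains of the maps applied to them, and that  *)
(* the restriction maps have the expected images.                             *)

Definition sm_edge (F : face M) (e : edge M) : edge M :=
  if [pick d in val F :&: val e] is Some d then edge_of (phi M d) else e.

Definition sm_vertex (F : face M) (v : vertex M) : vertex M :=
  if [pick d in val F :&: val v] is Some d then vertex_of (phi M d) else v.

Lemma sm_side_edge2 F s : (val (sm_side_edge F s)).2 = sm_edge F (val s).2.
Proof.
rewrite /sm_edge; case: pickP => [d|nF].
  rewrite inE mem_face mem_edge => /andP[/eqP<- /eqP ed].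
  by rewrite sm_side_edgeE.
rewrite sm_side_edge_fix //; apply/negP=> /set0Pn[d].
by rewrite nF.
Qed.

Lemma sm_corner2 F c : (val (sm_corner F c)).2 = sm_vertex F (val c).2.
Proof.
rewrite /sm_vertex; case: pickP => [d|nF].
  rewrite inE mem_face mem_vertex => /andP[/eqP<- /eqP ed].
  by rewrite sm_cornerE.
rewrite sm_corner_fix //; apply/negP=> /set0Pn[d].
by rewrite nF.
Qed.

Lemma Rubik_sub_corner_edge : Rubik M \subset compatible to_corner_edge.
Proof.
rewrite gen_subG; apply/subsetP=> _ /imsetP[F _ ->].
pose f (y : corner M + edge M) : corner M + edge M :=
  match y with inl c => inl (sm_corner F c) | inr e => inr (sm_edge F e) end.
apply: (compatible_fun to_corner_edge_onto (f := f)) => -[c|s]; rewrite permE //=.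
by rewrite sm_side_edge2.
Qed.

Lemma Rubik_sub_corner : Rubik M \subset compatible (@corner_part (side_edge M)).
Proof.
rewrite gen_subG; apply/subsetP=> _ /imsetP[F _ ->].
apply: (compatible_fun (@corner_part_onto _) (f := sm_corner F)) => -[c|s];
  by rewrite permE.
Qed.

Lemma Rubik_sub_vertex : Rubik M \subset compatible vertex_part.
Proof.
rewrite gen_subG; apply/subsetP=> _ /imsetP[F _ ->].
apply: (compatible_fun vertex_part_onto (f := sm_vertex F)) => -[c|s];
  by rewrite permE //= sm_corner2.
Qed.

Lemma Rubik_corner_edge_sub_corner :
  Rubik_corner_edge \subset compatible (@corner_part (edge M)).
Proof.
apply: (induced_sub to_corner_edge_onto Rubik_sub_corner_edge Rubik_sub_corner).
by case=> [c|s].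
Qed.

Lemma Rubik_corner_edge_sub_edge : Rubik_corner_edge \subset compatible edge_part.
Proof.
rewrite /Rubik_corner_edge /= morphimEsub ?Rubik_sub_corner_edge //; apply/subsetP=> _ /imsetP[g Gg ->] /=.
have /inducedP/forallP ig := subsetP Rubik_sub_corner_edge _ Gg.
have /inducedP/forallP jg := subsetP Rubik_sub_corner _ Gg.
set p := induced _ g in ig *.
have pl c : exists c', p (inl c) = inl c'.
  have := ig (inl c); have := jg (inl c); case: (g (inl c)) => //= c' _ /eqP[<-].
  by exists c'.
have pinl c c' : p (inl c) = inl c' -> forall e, p (inr e) != inl c'.
  by move=> <- e; apply/eqP=> /perm_inj.
have pr e : exists e', p (inr e) = inr e'.
  case E: (p (inr e)) => [c|e']; last by exists e'.
  pose q := induced (@corner_part (side_edge M)) g.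
  have := jg (inl (q^-1 c)); have := ig (inl (q^-1 c)).
  rewrite /= -/q permKV; case: (g _) => //= c' /eqP[pc] /eqP[cc].
  by have := pinl _ _ (esym pc) e; rewrite E cc eqxx.
pose f e := if p (inr e) is inr e' then e' else e.
apply: (compatible_fun edge_part_onto (f := f)) => -[c|e] /=.
  by have [c' ->] := pl c.
by rewrite /f; have [e' ->] := pr e.
Qed.

Lemma Rubik_corner_sub_vertex : Rubik_corner \subset compatible to_vertex.
Proof. by apply: (induced_sub (@corner_part_onto _) Rubik_sub_corner Rubik_sub_vertex) => -[c|s]. Qed.

Lemma restriction_corner_edge :
  induced_morphism (@corner_part_onto (edge M)) @* Rubik_corner_edge = Rubik_corner.
Proof. by apply: (induced_im to_corner_edge_onto (@corner_part_onto _)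
  (@corner_part_onto _) Rubik_sub_corner_edge Rubik_sub_corner) => -[c|s]. Qed.

Lemma restriction_vertex :
  induced_morphism vertex_onto @* Rubik_corner = Rubik_vertex.
Proof. by apply: (induced_im (@corner_part_onto _) vertex_onto
  vertex_part_onto Rubik_sub_corner Rubik_sub_vertex) => -[c|s]. Qed.

End RubikGroups.

(* Main.v *)
Require Import Defs.
From mathcomp Require Import all_boot all_order all_fingroup all_algebra all_solvable.

(** Corners and side edges both correspond to darts, and a side movement along
    F sends r^k d to r^k (phi d) for d on F, where r = rot for corners and
    r = opp for side edges.  Pick heights h with h (r d) = h d + 1 in Z_3 (resp.
    Z_2).  The shift h (g x) - h x of an element g of the group depends only on
    the vertex (edge) of x, and the sum of the shifts over all vertices (edges)
    is a homomorphism that vanishes on side movements, because it may be computed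
    with representatives on F, which the movement permutes.  An element that
    fixes every vertex (edge) is determined by its shifts, and they sum to zero:
    this gives (i) and (iii).
    On corners and edges a side movement acts by four copies of the rotation of
    its face, hence evenly: this gives (ii).  For (iv), a face of odd size turns
    its vertices by a permutation of odd order. *)

Set Implicit Arguments.
Unset Strict Implicit.
Unset Printing Implicit Defensive.

Import GroupScope GRing.Theory.

(* burnside_app shadows rot and opp. *)
Import Defs.

(** * Permutations shifting fibre heights by total zero *)

Section Balanced.

Variables (X B : finType) (n : nat).
Variables (b : X -> B) (h : X -> 'Z_n) (s : B -> X).
Hypothesis sK : cancel s b.

Definition shift (g : {perm X}) (x : X) : 'Z_n := (h (g x) - h x)%R.

Definition fibrewise (g : {perm X}) : bool :=
  [forall x, forall y, (b x == b y) ==>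
     ((b (g x) == b (g y)) && (shift g x == shift g y))].

Definition balanced : {set {perm X}} :=
  [set g | fibrewise g && ((\sum_v shift g (s v))%R == 0%R)].

Lemma fibrewiseP (g : {perm X}) :
  reflect (forall x y, b x = b y -> b (g x) = b (g y) /\ shift g x = shift g y)
          (fibrewise g).
Proof.
apply: (iffP forallP) => [gP x y /eqP bxy|gP x].
  by have /forallP/(_ y)/implyP/(_ bxy)/andP[/eqP ? /eqP ?] := gP x.
apply/forallP=> y; apply/implyP=> /eqP/gP[-> ->].
by rewrite !eqxx.
Qed.

Lemma shiftM g g' x : shift (g * g') x = (shift g x + shift g' (g x))%R.
Proof. by rewrite /shift permM [RHS]addrC addrA subrK. Qed.

(** [g^-1] is not assumed fibrewise, so only surjectivity is checked, with [f'] as right inverse;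
    finiteness of [B] does the rest. *)
Lemma fibrewise_bij g : fibrewise g -> bijective (fun v => b (g (s v))).
Proof.
move/fibrewiseP=> gP; apply: injF_bij.
pose f' w := b (g^-1 (s w)).
have fK : cancel f' (fun v => b (g (s v))).
  move=> w; rewrite /f'; have [-> _] := gP _ _ (sK (b (g^-1 (s w)))).
  by rewrite permKV sK.
exact: can_inj (canF_sym fK).
Qed.

(* The total shift does not depend on the section used to compute it. *)
Lemma sum_shift_section g s' : fibrewise g -> cancel s' b ->
  (\sum_v shift g (s v) = \sum_v shift g (s' v))%R.
Proof.
by move=> /fibrewiseP gP s'K; apply: eq_bigr => v _; apply: (gP _ _ _).2; rewrite sK.
Qed.

(** By [fibrewise_bij] the sum on the left runs over all fibres again, only in another order. *)
Lemma sum_shift_comp g g' : fibrewise g -> fibrewise g' ->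
  (\sum_v shift g' (g (s v)) = \sum_v shift g' (s v))%R.
Proof.
move=> fg /fibrewiseP g'P; rewrite [RHS](reindex _ (onW_bij _ (fibrewise_bij fg))) /=.
by apply: eq_bigr => v _; apply: (g'P _ _ _).2; rewrite sK.
Qed.

Lemma balanced_group_set : group_set balanced.
Proof.
apply/group_setP; split=> [|g g'].
  rewrite inE; apply/andP; split.
    by apply/fibrewiseP=> x y; rewrite /shift !perm1 !subrr.
  by rewrite big1 // => v _; rewrite /shift perm1 subrr.
rewrite !inE => /andP[fg /eqP Tg] /andP[fg' /eqP Tg'].
apply/andP; split; last first.
  rewrite (eq_bigr _ (fun v _ => shiftM g g' (s v))) big_split /= Tg.
  by rewrite sum_shift_comp // Tg' addr0.
apply/fibrewiseP=> x y bxy; have [b1 s1] := fibrewiseP _ fg _ _ bxy.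
have [b2 s2] := fibrewiseP _ fg' _ _ b1.
by rewrite !shiftM !permM s1 s2.
Qed.

Canonical balanced_group := Group balanced_group_set.

(** When [g] permutes the representatives [s' v], the heights after [g] are a rearrangement of the
    heights before, so the total shift cancels. *)
Lemma balanced_stable_section g s' : fibrewise g -> cancel s' b ->
  (forall v, g (s' v) = s' (b (g (s' v)))) -> g \in balanced.
Proof.
move=> fg s'K gs'; rewrite inE fg (sum_shift_section (s' := s')) //= /shift sumrB subr_eq0.
apply/eqP; rewrite [RHS](reindex _ (onW_bij _ (fibrewise_bij fg))) /=.
apply: eq_bigr => v _; rewrite gs'; congr (h (s' _)).
by apply: (fibrewiseP _ fg _ _ _).1; rewrite sK.
Qed.

(** [lift (enum_rank b0)] enumerates the indices other than that of [b0]. *)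
Definition shift_row (b0 : B) (g : {perm X}) : 'rV['Z_n]_(#|{: B}|.-1) :=
  (\row_j shift g (s (enum_val (lift (enum_rank b0) j))))%R.

(* Since the shifts add up to zero, the one at b0 may be dropped. *)
Lemma balanced_kernel_isog (b0 : B) (K : {group {perm X}}) :
    (forall x y, b x = b y -> h x = h y -> x = y) ->
    K \subset balanced -> (forall g x, g \in K -> b (g x) = b x) ->
  exists A : {group 'rV['Z_n]_(#|{: B}|.-1)}, K \isog A.
Proof.
move=> bh_inj /subsetP sK' Kb.
have fK g : g \in K -> fibrewise g by move/sK'; rewrite inE => /andP[].
have TK g : g \in K -> (\sum_v shift g (s v) = 0)%R.
  by move/sK'; rewrite inE => /andP[_ /eqP].
(* Shifts add along a product because [K] keeps every point in its fibre, where [g'] has a constant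
   shift. *)
have fM : {in K &, {morph shift_row b0 : g g' / g * g'}}.
  move=> g g' Kg Kg'; apply/rowP=> j; rewrite !mxE shiftM; congr (_ + _)%R.
  by apply: (fibrewiseP _ (fK _ Kg') _ _ _).2; rewrite Kb.
exists (Morphism fM @* K)%G; apply: sub_isog => //.
apply/subsetP=> g /morphpreP[Kg /set1P g0]; apply/set1P/permP=> x.
rewrite perm1; have g0' v : v != b0 -> shift g (s v) = 0%R.
  move=> vb0; case: (unliftP (enum_rank b0) (enum_rank v)) => [j|] ev; last first.
    by rewrite (enum_rank_inj ev) eqxx in vb0.
  by move/rowP/(_ j): g0; rewrite !mxE -ev enum_rankK.
have gb0 : shift g (s b0) = 0%R.
  by have := TK g Kg; rewrite (bigD1 b0) //= big1 ?addr0.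
(* [g x] and [x] share their fibre, and zero shift gives them the same height. *)
apply: bh_inj; first exact: Kb.
have := (fibrewiseP _ (fK _ Kg) _ _ (sK (b x))).2.
have -> : shift g (s (b x)) = 0%R by have [->|/g0'] := eqVneq (b x) b0.
by move/esym/eqP; rewrite subr_eq0 => /eqP.
Qed.

End Balanced.

(** * Heights modulo n along orbits of length n *)

Section Heights.

Variables (D : finType) (r : {perm D}) (n : nat).
Hypotheses (n_gt1 : 1 < n) (r_card : forall d, #|porbit r d| = n).

(** The pick depends on the orbit alone, so all its points share one base; the default never occurs,
    since the orbit contains [d]. *)
Definition orbit_base (d : D) : D := odflt d [pick x in porbit r d].

Definition height (d : D) : 'Z_n := (index d (traject r (orbit_base d) n))%:R%R.

Lemma orbit_base_porbit d d' : porbit r d = porbit r d' -> orbit_base d = orbit_base d'.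
Proof.
rewrite /orbit_base => ->; case: pickP => // /(_ d').
by rewrite porbit_id.
Qed.

Lemma permX_dvd d k : n %| k -> (r ^+ k) d = d.
Proof.
move=> /dvdnP[j ->]; rewrite mulnC expgM; elim: j => [|j IH].
  by rewrite expg0 perm1.
by rewrite expgS permM (permX r d n) -{2}(r_card d) iter_porbit.
Qed.

Lemma height_base d i : height ((r ^+ i) (orbit_base d)) = (i%:R)%R.
Proof.
have base_mem x : porbit r (orbit_base x) = porbit r x.
  rewrite /orbit_base; case: pickP => //= y; rewrite -eq_porbit_mem.
  by move/eqP.
pose x0 := orbit_base d.
(* Reducing the exponent below [n] puts the point into the duplicate-free traject, where [index]
   recovers the exponent. *)
have -> : (r ^+ i) x0 = (r ^+ (i %% n)) x0.
  by rewrite {1}(divn_eq i n) expgD permM (@permX_dvd x0 (_ * n)) ?dvdn_mull.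
have im : i %% n < n by rewrite ltn_mod ltnW.
rewrite /height (@orbit_base_porbit _ d) -/x0; last first.
  by rewrite porbit_perm base_mem.
rewrite permX -(nth_traject r im x0) index_uniq ?size_traject //; last first.
  by rewrite -(r_card x0) uniq_traject_porbit.
by rewrite -[RHS](Zp_nat_mod n_gt1).
Qed.

Lemma heightX d i : height ((r ^+ i) d) = (height d + i%:R)%R.
Proof.
have /porbitP[k ->] : d \in porbit r (orbit_base d).
  rewrite /orbit_base; case: pickP => [x|]; first by rewrite /= porbit_sym.
  by move/(_ d); rewrite porbit_id.
by rewrite -permM -expgD !height_base natrD.
Qed.

End Heights.
Arguments height {D} r n d.

(** * Turning a set of darts is balanced *)

Section Turn.

(* phi turns a set F of darts meeting each r-orbit at most once, and g drags  *)
(* the r-orbits along: this covers side movements on corners (r = rot) and on *)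
(* side edges (r = opp).                                                      *)
Variables (D X B : finType) (r phi : {perm D}) (n : nat) (F : {set D}).
Variables (cell : D -> X) (dart_of : X -> D) (b : X -> B) (s : B -> X).
Variable g : {perm X}.
Hypotheses (n_gt1 : 1 < n) (r_card : forall d, #|porbit r d| = n).
Hypotheses (sK : cancel s b) (dartK : cancel dart_of cell).
Hypothesis cellK : cancel cell dart_of.
Hypothesis b_cell : forall d d', (b (cell d) == b (cell d')) = (d \in porbit r d').
Hypothesis F_phi : forall d, d \in F -> phi d \in F.
Hypothesis F_simple : {in F &, forall d d', d \in porbit r d' -> d = d'}.
Hypothesis g_turn :
  forall d i, d \in F -> g (cell ((r ^+ i) d)) = cell ((r ^+ i) (phi d)).
Hypothesis g_fix :
  forall x, (forall d, d \in F -> b (cell d) != b x) -> g x = x.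

Let h (x : X) : 'Z_n := height r n (dart_of x).

(** Darts of one orbit differ by some [r ^+ i]; equal heights force [n] to divide [i], and then
    [r ^+ i] is trivial. *)
Lemma cell_inj_height x y : b x = b y -> h x = h y -> x = y.
Proof.
rewrite /h -(dartK x) -(dartK y) !cellK => /eqP.
rewrite b_cell => /porbitP[i ->]; rewrite heightX // => /eqP.
rewrite -subr_eq0 addrC addKr => /eqP i0; congr cell.
have : (i %% n = 0)%N.
  by have := val_Zp_nat n_gt1 i; rewrite i0.
by move/eqP/permX_dvd; apply.
Qed.

Lemma turn_balanced : g \in balanced b h s.
Proof.
pose over x := [pick d in F | b (cell d) == x].
(* Over an orbit met by [F] the representative is the cell of its dart in [F]; over the others [g]
   is the identity and [s] serves. *)
pose s' v := if over v is Some d then cell d else s v.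
(* The power of [r] leading from [d] to the dart of [x] is kept by [g], so it cancels from the
   shift. *)
have turnP x d : d \in F -> b (cell d) = b x ->
    b (g x) = b (cell (phi d)) /\
    (h (g x) - h x = height r n (phi d) - height r n d)%R.
  move=> Fd /eqP; rewrite -(dartK x) eq_sym b_cell => /porbitP[i ->].
  rewrite g_turn // /h !cellK; split.
    by apply/eqP; rewrite b_cell mem_porbit.
  by rewrite !heightX // opprD addrACA subrr addr0.
have s'K : cancel s' b.
  by move=> v; rewrite /s' /over; case: pickP => [d /andP[_ /eqP]|_].
have fg : fibrewise b h g.
  apply/fibrewiseP=> x y bxy; rewrite /shift.
  case: (pickP [pred d in F | b (cell d) == b x]) => [d /andP[Fd /eqP bd]|no].
    have [-> ->] := turnP x d Fd bd; have [-> ->] := turnP y d Fd (etrans bd bxy).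
    by [].
  have nF d : d \in F -> b (cell d) != b x by move=> Fd; have := no d; rewrite inE Fd /= => ->.
  by rewrite !g_fix -?bxy // !subrr.
apply: (balanced_stable_section sK fg s'K) => v.
rewrite {1 3}/s' /over; case: pickP => [d /andP[Fd /eqP bd]|no].
  have gd : g (cell d) = cell (phi d) by have := g_turn 0 Fd; rewrite expg0 !perm1.
  (* The representative chosen over the orbit of [phi d] is the cell of [phi d] itself, as [F] meets
     that orbit only once. *)
  rewrite gd /s' /over; case: pickP => [d' /andP[Fd']|/(_ (phi d))].
    by rewrite b_cell => /F_simple-> //; apply: F_phi.
  by rewrite F_phi //= eqxx.
rewrite g_fix => [|d Fd]; rewrite sK; last by have := no d; rewrite Fd /= => ->.
by rewrite /s' /over; case: pickP => // d; rewrite no.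
Qed.

End Turn.

(** * Parity of extended and doubled permutations *)

Lemma odd_perm_extend (T Y : finType) (i : T -> Y) (q : {perm T}) (p : {perm Y}) :
    injective i -> (forall t, p (i t) = i (q t)) ->
    (forall y, (forall t, i t != y) -> p y = y) ->
  odd_perm p = odd_perm q.
Proof.
move=> i_inj; have [ts -> {q}] := prod_tpermP q.
elim: ts p => [|[x y] ts IH] p /= => [_|/andP[xy dts]] pi pfix.
  rewrite big_nil odd_perm1; have -> : p = 1; last by rewrite odd_perm1.
  apply/permP=> z; rewrite perm1.
  have [/existsP[t /eqP <-]|] := boolP [exists t, i t == z].
    by rewrite pi big_nil perm1.
  by rewrite negb_exists => /forallP; apply: pfix.
rewrite big_cons odd_permM odd_tperm; rewrite /dpair /= in xy; rewrite xy addTb.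
(* Composing [p] with the image of the leading transposition of [q] cancels it, leaving an extension
   of the remaining product. *)
rewrite -(IH (tperm (i x) (i y) * p)) //.
- by rewrite odd_permM odd_tperm (inj_eq i_inj) xy addTb negbK.
- by move=> t; rewrite permM -inj_tperm // pi big_cons permM tpermK.
- by move=> z zi; rewrite permM tpermD ?pfix.
Qed.

(** [p] is the product of [q] acting on one copy and [q] acting on the other, two factors of equal
    parity. *)
Lemma even_double_perm (T : finType) (q : {perm T}) (p : {perm bool * T}) :
  (forall a t, p (a, t) = (a, q t)) -> odd_perm p = false.
Proof.
move=> pE; pose f (c : bool) (x : bool * T) := (x.1, if x.1 == c then q x.2 else x.2).
have f_inj c : injective (f c).
  move=> [a t] [a' t'] [<-] /=; case: (a == c) => [/perm_inj|] -> //.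
have f_odd c : odd_perm (perm (f_inj c)) = odd_perm q.
  apply: (@odd_perm_extend _ _ (pair c)) => [t t' []|t|[a t] nc] //.
    by rewrite permE /f /= eqxx.
  rewrite permE /f /=; case: eqP => // ac.
  by have := nc t; rewrite ac eqxx.
have -> : p = perm (f_inj true) * perm (f_inj false).
  by apply/permP=> -[[] t]; rewrite pE permM !permE /f.
by rewrite odd_permM !f_odd addbb.
Qed.

(** * Corners and side edges as darts *)

Section Cells.

Variable M : cubic_map.
Implicit Types (d : dart M) (F : face M).

Lemma corner_of_proof d : on_face (face_of d) (val (vertex_of d)).
Proof. by apply/on_face_vertexP; exists d. Qed.

Definition corner_of d : corner M :=
  exist _ (face_of d, vertex_of d) (corner_of_proof d).

Lemma corner_of_onto (c : corner M) : exists d, corner_of d == c.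
Proof.
case: c => -[F v] c_on; have /on_face_vertexP[d fd vd] := c_on.
by exists d; rewrite -val_eqE /= fd vd.
Qed.

Definition corner_dart (c : corner M) : dart M := xchoose (corner_of_onto c).

Lemma corner_dartK : cancel corner_dart corner_of.
Proof. by move=> c; apply/eqP/(xchooseP (corner_of_onto c)). Qed.

Lemma corner_ofK : cancel corner_of corner_dart.
Proof.
move=> d; have /(congr1 val)[] := corner_dartK (corner_of d).
by move=> ef ev; apply: face_vertex_inj; apply: val_inj.
Qed.

Lemma side_of_proof d : on_face (face_of d) (val (edge_of d)).
Proof. by apply/on_face_edgeP; exists d. Qed.

Definition side_of d : side_edge M :=
  exist _ (face_of d, edge_of d) (side_of_proof d).

Lemma side_of_onto (c : side_edge M) : exists d, side_of d == c.
Proof.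
case: c => -[F e] c_on; have /on_face_edgeP[d fd ed] := c_on.
by exists d; rewrite -val_eqE /= fd ed.
Qed.

Definition side_dart (c : side_edge M) : dart M := xchoose (side_of_onto c).

Lemma side_dartK : cancel side_dart side_of.
Proof. by move=> c; apply/eqP/(xchooseP (side_of_onto c)). Qed.

Lemma side_ofK : cancel side_of side_dart.
Proof.
move=> d; have /(congr1 val)[] := side_dartK (side_of d).
by move=> ef ee; apply: face_edge_inj; apply: val_inj.
Qed.

(** The darts [d], [rot d] and [rot (rot d)] lie in F, G_(i-1) and G_i, so exponents 0, 1, 2 are the
    three cases defining the movement; higher ones reduce modulo 3. *)
Lemma sm_corner_rot F d i : d \in val F ->
  sm_corner F (corner_of ((rot M ^+ i) d)) = corner_of ((rot M ^+ i) (phi M d)).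
Proof.
rewrite mem_face => /eqP <-; rewrite !permX.
have [a1 a2 a3] := faces_neq d.
elim/ltn_ind: i => -[|[|[|i]]] IH; last by rewrite !iterS !rot3 IH // ltnS leqW.
- by apply: val_inj; rewrite sm_cornerE //= eqxx face_of_phi.
- apply: val_inj; rewrite sm_cornerE /= ?vertex_of_rot // across_phi.
  by rewrite eq_sym (negPf a1) (negPf a3).
- apply: val_inj; rewrite sm_cornerE /= ?vertex_of_rot // -!across_rot.
  by rewrite eq_sym (negPf a2) eqxx.
Qed.

Lemma sm_side_opp F d i : d \in val F ->
  sm_side_edge F (side_of ((opp M ^+ i) d)) = side_of ((opp M ^+ i) (phi M d)).
Proof.
rewrite mem_face => /eqP <-; rewrite !permX.
have [_ a2 _] := faces_neq d.
elim/ltn_ind: i => -[|[|i]] IH; last by rewrite !iterS !opp2 IH // ltnS leqW.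
- by apply: val_inj; rewrite sm_side_edgeE //= eqxx face_of_phi.
- apply: val_inj; rewrite sm_side_edgeE /= ?edge_of_opp //.
  by rewrite eq_sym (negPf a2).
Qed.

Lemma face_phi F d : d \in val F -> phi M d \in val F.
Proof. by rewrite !mem_face face_of_phi. Qed.

Lemma sm_edgeE F d : d \in val F -> sm_edge F (edge_of d) = edge_of (phi M d).
Proof.
move=> Fd; rewrite -[edge_of d]/(val (side_of d)).2 -sm_side_edge2.
by have := sm_side_opp 0 Fd; rewrite expg0 !perm1 => ->.
Qed.

Lemma sm_edge_fix F e : (forall d, d \in val F -> edge_of d != e) -> sm_edge F e = e.
Proof.
move=> nF; rewrite /sm_edge; case: pickP => // d.
by rewrite inE mem_edge => /andP[/nF/negPf->].
Qed.

Lemma sm_vertexE F d : d \in val F -> sm_vertex F (vertex_of d) = vertex_of (phi M d).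
Proof.
move=> Fd; rewrite -[vertex_of d]/(val (corner_of d)).2 -sm_corner2.
by have := sm_corner_rot 0 Fd; rewrite expg0 !perm1 => ->.
Qed.

Lemma sm_vertex_fix F v :
  (forall d, d \in val F -> vertex_of d != v) -> sm_vertex F v = v.
Proof.
move=> nF; rewrite /sm_vertex; case: pickP => // d.
by rewrite inE mem_vertex => /andP[/nF/negPf->].
Qed.

Lemma sm_corner_off F (c : corner M) :
  (forall d, d \in val F -> vertex_of d != (val c).2) -> sm_corner F c = c.
Proof.
move=> nF; apply: sm_corner_fix; apply/on_face_vertexP=> -[d /eqP fd vd].
by have := nF d; rewrite mem_face fd vd eqxx => /(_ isT).
Qed.

Lemma sm_side_off F (c : side_edge M) :
  (forall d, d \in val F -> edge_of d != (val c).2) -> sm_side_edge F c = c.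
Proof.
move=> nF; apply: sm_side_edge_fix; apply/on_face_edgeP=> -[d /eqP fd vd].
by have := nF d; rewrite mem_face fd vd eqxx => /(_ isT).
Qed.

(** * Actions induced by the generators *)

Lemma side_movement_Rubik F : side_movement F \in Rubik M.
Proof. by apply/mem_gen/imset_f. Qed.

Lemma induced_eq (X Y : finType) (pi : X -> option Y) (g : {perm X}) x y :
  g \in compatible pi -> pi x = Some y -> pi (g x) = Some (induced pi g y).
Proof. by move=> /inducedP/forallP/(_ x)/eqP-> ->. Qed.

Lemma induced_corner F (c : corner M) :
  induced (@corner_part M (side_edge M)) (side_movement F) c = sm_corner F c.
Proof.
have := induced_eq (subsetP (Rubik_sub_corner M) _ (side_movement_Rubik F))
  (erefl : corner_part (inl c) = Some c).
by rewrite permE /= => -[].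
Qed.

Lemma induced_vertex F (v : vertex M) :
  induced (@vertex_part M) (side_movement F) v = sm_vertex F v.
Proof.
have [c [cv]] := vertex_onto v.
have := induced_eq (subsetP (Rubik_sub_vertex M) _ (side_movement_Rubik F))
  (erefl : vertex_part (inl c) = Some (val c).2).
by rewrite permE /= sm_corner2 cv => -[].
Qed.

Lemma induced_corner_edge_inl F (c : corner M) :
  induced (@to_corner_edge M) (side_movement F) (inl c) = inl (sm_corner F c).
Proof.
have := induced_eq (subsetP (Rubik_sub_corner_edge M) _ (side_movement_Rubik F))
  (erefl : to_corner_edge (inl c) = Some (inl c)).
by rewrite permE /= => -[].
Qed.

Lemma induced_corner_edge_inr F (e : edge M) :
  induced (@to_corner_edge M) (side_movement F) (inr e) = inr (sm_edge F e).
Proof.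
have [c ce] := edge_onto e.
have := induced_eq (subsetP (Rubik_sub_corner_edge M) _ (side_movement_Rubik F))
  (erefl : to_corner_edge (inr c) = Some (inr (val c).2)).
by rewrite permE /= sm_side_edge2 ce => -[].
Qed.

(** Serves to move [H1] onto side edges alone, where the balance argument applies. *)
Definition side_part (x : corner M + side_edge M) : option (side_edge M) :=
  if x is inr c then Some c else None.

Lemma side_part_onto c : exists x, side_part x = Some c.
Proof. by exists (inr c). Qed.

Lemma Rubik_sub_side : Rubik M \subset compatible side_part.
Proof.
rewrite gen_subG; apply/subsetP=> _ /imsetP[F _ ->].
by apply: (compatible_fun side_part_onto (f := sm_side_edge F)) => -[c|c]; rewrite permE.
Qed.

Lemma induced_side F (c : side_edge M) :
  induced side_part (side_movement F) c = sm_side_edge F c.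
Proof.
have := induced_eq (subsetP Rubik_sub_side _ (side_movement_Rubik F))
  (erefl : side_part (inr c) = Some c).
by rewrite permE /= => -[].
Qed.

(** The preimage of [A] is a group, so it is enough that it contains the generators. *)
Lemma Rubik_im_sub (Y : finType) (pi : corner M + side_edge M -> option Y)
    (pi_onto : forall y, exists x, pi x = Some y) (A : {group {perm Y}}) :
    Rubik M \subset compatible pi ->
    (forall F, induced pi (side_movement F) \in A) ->
  induced_morphism pi_onto @* Rubik M \subset A.
Proof.
move=> sR HA; rewrite sub_morphim_pre // gen_subG.
apply/subsetP=> _ /imsetP[F _ ->]; apply/morphpreP; split; last exact: HA.
exact: (subsetP sR _ (side_movement_Rubik F)).
Qed.

(** * Embedding the twist groups of vertices and edges *)

Lemma vertex_of_onto (v : vertex M) : exists d, vertex_of d == v.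
Proof.
by case: v => A vA; have /imsetP[d _ eA] := vA; exists d; rewrite -val_eqE /= eA.
Qed.

Lemma edge_of_onto (e : edge M) : exists d, edge_of d == e.
Proof.
by case: e => A eA; have /imsetP[d _ eA'] := eA; exists d; rewrite -val_eqE /= eA'.
Qed.

Lemma dart_exists : exists d : dart M, true.
Proof. by have /card_gt0P[d _] := dart_gt0 M; exists d. Qed.

Lemma H3_isog : exists A : {group 'rV['Z_3]_(#|{: vertex M}|.-1)}, H3 M \isog A.
Proof.
pose b (c : corner M) := (val c).2.
pose s v := corner_of (xchoose (vertex_of_onto v)).
have sK : cancel s b by move=> v; apply/eqP/(xchooseP (vertex_of_onto v)).
have b_cell d d' : (b (corner_of d) == b (corner_of d')) = (d \in porbit (rot M) d').
  exact: vertex_of_eq.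
have [d0 _] := dart_exists.
(* Passing [cell_inj_height] also fixes the height to be the position of the dart in its
   [rot]-orbit. *)
apply: (balanced_kernel_isog sK (vertex_of d0)
  (cell_inj_height (n := 3) isT (@rot_card M) corner_dartK corner_ofK b_cell)).
  apply: subset_trans (subsetIl _ _) _; apply: Rubik_im_sub (Rubik_sub_corner M) _ => F.
  apply: (turn_balanced (phi := phi M) (F := val F) (n := 3) isT (@rot_card M) sK
    corner_dartK corner_ofK b_cell).
  - exact: face_phi.
  - move=> d d'; rewrite !mem_face -vertex_of_eq => /eqP <- /eqP ef /eqP ev.
    exact: face_vertex_inj.
  - by move=> d i Fd; rewrite induced_corner sm_corner_rot.
  - by move=> c nF; rewrite induced_corner sm_corner_off.
move=> g c /setIP[Rg kg]; have g1 := mker kg.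
have [] := induced_eq (subsetP (Rubik_corner_sub_vertex M) _ Rg)
  (erefl : to_vertex c = Some (b c)).
by rewrite -[induced _ g]/(induced_morphism (@vertex_onto M) g) g1 perm1.
Qed.

Lemma H1_isog : exists A : {group 'rV['Z_2]_(#|{: edge M}|.-1)}, H1 M \isog A.
Proof.
pose b (c : side_edge M) := (val c).2.
pose s v := side_of (xchoose (edge_of_onto v)).
have sK : cancel s b by move=> v; apply/eqP/(xchooseP (edge_of_onto v)).
have b_cell d d' : (b (side_of d) == b (side_of d')) = (d \in porbit (opp M) d').
  exact: edge_of_eq.
have [d0 _] := dart_exists.
pose f := induced_morphism side_part_onto.
have sH1R : H1 M \subset Rubik M by apply: subsetIl.
have sH1 : H1 M \subset compatible side_part by apply: subset_trans sH1R Rubik_sub_side.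
have H1E g x : g \in H1 M -> to_corner_edge (g x) = to_corner_edge x.
  case/setIP=> Rg kg; have g1 := mker kg.
  have [y xy] : exists y, to_corner_edge x = Some y by case: x => z; eexists.
  rewrite (induced_eq (subsetP (Rubik_sub_corner_edge M) _ Rg) xy).
  by rewrite -[induced _ g]/(induced_morphism (@to_corner_edge_onto M) g) g1 perm1.
have H1side g c : g \in H1 M -> g (inr c) = inr (f g c).
  move=> Hg; have := induced_eq (subsetP sH1 _ Hg) (erefl : side_part (inr c) = Some c).
  by case: (g (inr c)) => //= c' [->].
(* Elements of [H1] fix every corner, so restricting them to side edges loses nothing. *)
have isoH1 : H1 M \isog f @* H1 M.
  have inj : 'injm (restrm sH1 f).
    rewrite ker_restrm; apply/subsetP=> g /setIP[Hg kg]; apply/set1P/permP=> -[c|c].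
      have := H1E g (inl c) Hg; rewrite perm1.
      by case: (g (inl c)) => //= c' [->].
    by rewrite H1side // (mker kg) !perm1.
  by have := sub_isog (subxx (H1 M)) inj; rewrite morphim_restrm setIid.
suff [A isoA] : exists A : {group 'rV['Z_2]_(#|{: edge M}|.-1)}, f @* H1 M \isog A.
  by exists A; apply: isog_trans isoH1 isoA.
apply: (balanced_kernel_isog sK (edge_of d0)
  (cell_inj_height (n := 2) isT (@opp_card M) side_dartK side_ofK b_cell)).
  apply: subset_trans (morphimS f sH1R) _; apply: Rubik_im_sub Rubik_sub_side _ => F.
  apply: (turn_balanced (phi := phi M) (F := val F) (n := 2) isT (@opp_card M) sK
    side_dartK side_ofK b_cell).
  - exact: face_phi.
  - move=> d d'; rewrite !mem_face -edge_of_eq => /eqP <- /eqP ef /eqP ev.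
    exact: face_edge_inj.
  - by move=> d i Fd; rewrite induced_side sm_side_opp.
  - by move=> c nF; rewrite induced_side sm_side_off.
move=> _ c /morphimP[g _ Hg ->].
by have := H1E g (inr c) Hg; rewrite H1side // => -[].
Qed.

(** * Parity on corners and edges, and the edge action of [H2] *)

Lemma even_corner_edge F :
  odd_perm (induced (@to_corner_edge M) (side_movement F)) = false.
Proof.
pose T := {d : dart M | d \in val F}.
pose q0 (t : T) : T := exist _ (phi M (val t)) (face_phi (valP t)).
have q0_inj : injective q0.
  by move=> t t' /(congr1 val) /perm_inj e; apply: val_inj.
pose q1 (x : bool * T) := (x.1, perm q0_inj x.2).
have q1_inj : injective q1 by move=> [a t] [a' t'] [-> /perm_inj ->].
pose q2 (x : bool * (bool * T)) := (x.1, perm q1_inj x.2).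
have q2_inj : injective q2 by move=> [a t] [a' t'] [-> /perm_inj ->].
(* Two bits label the four copies of the boundary of F: three of corners, one of edges. Nesting the
   bits makes [q2] two copies of [q1], as [even_double_perm] requires. *)
pose i (x : bool * (bool * T)) : corner M + edge M :=
  let d := val x.2.2 in
  match x.1, x.2.1 with
  | false, false => inl (corner_of d)
  | false, true => inl (corner_of (rot M d))
  | true, false => inl (corner_of (rot M (rot M d)))
  | true, true => inr (edge_of d)
  end.
have corner_inj d d' : inl (corner_of d) = inl (corner_of d') :> corner M + edge M ->
    d = d'.
  by move=> [ef ev]; apply: face_vertex_inj; apply: val_inj.
have Fval (t : T) : face_of (val t) = F by apply/eqP; rewrite -mem_face (valP t).
have edge_inj (t t' : T) : edge_of (val t) = edge_of (val t') -> t = t'.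
  by move=> e; apply: val_inj; apply: face_edge_inj; rewrite ?Fval.
have T_inj (t t' : T) : val t = val t' -> t = t' by apply: val_inj.
(* The other two darts at a vertex of F lie in other faces, which keeps the three copies of corners
   disjoint. *)
have neq1 (t t' : T) : val t = rot M (val t') -> False.
  move=> e; have [/eqP + _ _] := faces_neq (val t').
  by apply; rewrite -e !Fval.
have neq2 (t t' : T) : val t = rot M (rot M (val t')) -> False.
  move=> e; have [_ /eqP + _] := faces_neq (val t').
  by apply; rewrite across_rot -e !Fval.
have i_inj : injective i.
  move=> [[] [[] t]] [[] [[] t']]; rewrite /i /= => e; try discriminate e.
  - by case: e => ee; rewrite (edge_inj t t') //; apply: val_inj.
  - by move/corner_inj/perm_inj/perm_inj/T_inj: e => ->.
  - by move/corner_inj/perm_inj/esym/neq1: e.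
  - by move/corner_inj/esym/neq2: e.
  - by move/corner_inj/perm_inj/neq1: e.
  - by move/corner_inj/perm_inj/T_inj: e => ->.
  - by move/corner_inj/esym/neq1: e.
  - by move/corner_inj/neq2: e.
  - by move/corner_inj/neq1: e.
  - by move/corner_inj/T_inj: e => ->.
set p := induced _ _.
rewrite (@odd_perm_extend _ _ i (perm q2_inj)) //.
- by apply: (even_double_perm (q := perm q1_inj)) => a t; rewrite (permE q2_inj).
- move=> [a [a' t]]; have Ft := valP t.
  rewrite !permE /q2 /= !permE /q1 /= !permE /i /=.
  case: a; case: a'; rewrite ?induced_corner_edge_inl ?induced_corner_edge_inr.
  + by rewrite sm_edgeE.
  + by have := sm_corner_rot 2 Ft; rewrite !permX /= => ->.
  + by have := sm_corner_rot 1 Ft; rewrite !permX /= => ->.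
  + by have := sm_corner_rot 0 Ft; rewrite !permX /= => ->.
(* A corner at a vertex of F belongs to one of the three corner copies, so anything outside the
   image of [i] is away from F and fixed. *)
move=> [c|e] no.
  rewrite induced_corner_edge_inl sm_corner_off // => d Fd; apply/eqP=> ev.
  move: no; rewrite -(corner_dartK c) in ev *; move=> no.
  have /vertex_dartP := esym ev; pose t : T := exist _ d Fd.
  case=> ed.
  - by have := no (false, (false, t)); rewrite /i /= ed eqxx.
  - by have := no (false, (true, t)); rewrite /i /= ed eqxx.
  - by have := no (true, (false, t)); rewrite /i /= ed eqxx.
rewrite induced_corner_edge_inr sm_edge_fix // => d Fd; apply/eqP=> ee.
by have := no (true, (true, exist _ d Fd)); rewrite /i /= ee eqxx.
Qed.

Lemma H2_corner g c : g \in H2 M -> g (inl c) = inl c.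
Proof.
case/setIP=> Rg kg; have g1 := mker kg.
have := induced_eq (subsetP (Rubik_corner_edge_sub_corner M) _ Rg)
  (erefl : corner_part (inl c) = Some c).
rewrite -[induced _ g]/(induced_morphism (@corner_part_onto M (edge M)) g) g1 perm1.
by case: (g (inl c)) => //= c' [->].
Qed.

Lemma H2_edge g e : g \in H2 M -> g (inr e) = inr (edge_action M g e).
Proof.
case/setIP=> Rg _.
have := induced_eq (subsetP (Rubik_corner_edge_sub_edge M) _ Rg)
  (erefl : edge_part (inr e) = Some e).
by case: (g (inr e)) => //= e' [->].
Qed.

(** Injectivity holds because corners are fixed, so the action on edges determines the element. *)
Lemma H2_misom : misom (H2 M) (edge_action M @* H2 M) (edge_action M).
Proof.
have sH2 : H2 M \subset compatible (@edge_part M).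
  exact: subset_trans (subsetIl _ _) (Rubik_corner_edge_sub_edge M).
have fM : morphic (H2 M) (edge_action M).
  by apply/morphicP=> g g' Hg Hg'; apply: morphM; apply: (subsetP sH2).
apply/misomP; exists fM; apply/isomP; split.
  apply/injmP=> g g' Hg Hg' e.
  apply/permP=> -[c|x]; first by rewrite !H2_corner.
  by rewrite !H2_edge // (e : edge_action M g = edge_action M g').
by rewrite morphimEdom [RHS]morphimEsub.
Qed.

(** * Parity on vertices and conclusion *)

Lemma face_size_card F : face_size F = #|val F|.
Proof.
rewrite /face_size -(card_in_imset (f := @edge_of M)) => [|d d'].
  apply: eq_card => e; rewrite inE; apply/on_face_edgeP/imsetP => [[d fd <-]|[d Fd ->]].
    by exists d; rewrite // mem_face fd.
  by exists d => //; apply/eqP; rewrite -mem_face.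
rewrite !mem_face => /eqP <- /eqP ef ee; exact: face_edge_inj.
Qed.

Lemma odd_permX (T : finType) (p : {perm T}) k :
  odd_perm (p ^+ k) = odd k && odd_perm p.
Proof.
elim: k => [|k IH]; first by rewrite expg0 odd_perm1.
by rewrite expgS odd_permM IH /=; case: (odd k); case: odd_perm.
Qed.

Lemma even_vertex F : odd (face_size F) ->
  odd_perm (induced (@vertex_part M) (side_movement F)) = false.
Proof.
set p := induced _ _; move=> oF.
(* Parity is a homomorphism to Z_2, so a trivial odd power forces [p] to be even. *)
suff pk : p ^+ face_size F = 1.
  by have := odd_permX p (face_size F); rewrite pk odd_perm1 oF.
apply/permP=> v; rewrite perm1 permX.
case: (pickP [pred d in val F | vertex_of d == v]) => [d /andP[/= Fd /eqP <-]|no].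
  have iterE k : iter k p (vertex_of d) = vertex_of (iter k (phi M) d).
    elim: k => //= k ->; rewrite induced_vertex sm_vertexE //.
    by elim: k => //= k; apply: face_phi.
  (* The number of edges of F is the length of the [phi]-orbit of [d], after which the iteration
     returns to [d]. *)
  rewrite iterE face_size_card; move: Fd; rewrite mem_face => /eqP <-.
  by rewrite iter_porbit.
have pv : p v = v.
  rewrite induced_vertex sm_vertex_fix // => d Fd.
  by have := no d; rewrite inE Fd /= => ->.
by elim: (face_size F) => //= k ->.
Qed.

Lemma Rubik_vertex_Alt : (forall F, odd (face_size F)) ->
  Rubik_vertex M \subset 'Alt_(vertex M).
Proof.
move=> oF; apply: Rubik_im_sub (Rubik_sub_vertex M) _ => F.
by rewrite Alt_even even_vertex.
Qed.

(** An element of [H2] extends its edge action by the identity on corners, so both have the same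
    parity, and every generator is even on corners and edges together. *)
Lemma H2_sub_Alt : edge_action M @* H2 M \subset 'Alt_(edge M).
Proof.
apply/subsetP=> _ /morphimP[g cg Hg ->]; rewrite Alt_even.
have [Rg _] := setIP Hg.
rewrite -(odd_perm_extend (i := inr) (p := g)) //.
- rewrite -Alt_even; apply: (subsetP _ _ Rg).
  apply: Rubik_im_sub (Rubik_sub_corner_edge M) _ => F.
  by rewrite Alt_even even_corner_edge.
- by move=> e e' [].
- by move=> e; rewrite H2_edge.
- move=> [c|e] ne; last by have := ne e; rewrite eqxx.
  exact: H2_corner.
Qed.

End Cells.

Theorem theorem3 (M : cubic_map) :
  [/\ (exists A : {group 'rV['Z_2]_(#|{: edge M}|.-1)}, H1 M \isog A),
      misom (H2 M) (edge_action M @* H2 M) (edge_action M)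
        /\ edge_action M @* H2 M \subset 'Alt_(edge M),
      (exists A : {group 'rV['Z_3]_(#|{: vertex M}|.-1)}, H3 M \isog A)
    & ((forall F : face M, odd (face_size F)) ->
         Rubik_vertex M \subset 'Alt_(vertex M))
      /\ (~ (forall F : face M, odd (face_size F)) ->
         Rubik_vertex M \subset 'Sym_(vertex M))].
Proof.
split; [exact: H1_isog | split; [exact: H2_misom | exact: H2_sub_Alt]
  | exact: H3_isog | split; first exact: Rubik_vertex_Alt].
(* The symmetric group is the full group of permutations. *)
by move=> _; apply: subsetT.
Qed.
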